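(* Let $G_1$ and $G_2$ be nontrivial finite groups that admit a DRR (respectively, a GRR), and suppose $\gcd(|G_1|,|G_2|)=1$. Then $G_1 \times G_2$ is not DRR-detecting (respectively, not GRR-detecting).
   Context: All groups and graphs are finite. For a subset $S$ of a group $G$, the Cayley digraph $\mathrm{Cay}(G,S)$ has vertex set $G$ and a directed edge from $g_1$ to $g_2$ iff $g_2 = s g_1$ for some $s \in S$; if $S$ is inverse-closed it is a graph (Cayley graph). $\mathrm{Aut}(G,S) = \{\varphi \in \mathrm{Aut}(G) : \varphi(S) = S\}$. A digraph $\Gamma$ is a DRR of $G$ if $\mathrm{Aut}(\Gamma) \cong G$ and acts regularly on the vertices; a GRR is a DRR that is a graph. $G$ admits a DRR (GRR) if some DRR (GRR) of $G$ exists. $G$ is GRR-detecting if for every inverse-closed $S \subseteq G$, $\mathrm{Aut}(G,S)=\{1\}$ implies $\mathrm{Cay}(G,S)$ is a GRR; $G$ is DRR-detecting if for every $S \subseteq G$, $\mathrm{Aut}(G,S)=\{1\}$ implies $\mathrm{Cay}(G,S)$ is a DRR. *)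

(* Defs.v *)
From HB Require Import structures.
From mathcomp Require Import all_boot all_fingroup.

Set Implicit Arguments.
Unset Strict Implicit.
Unset Printing Implicit Defensive.

Local Open Scope group_scope.

(** A finite group is a [finGroupType], taken with its full set of elements
    [[set: gT]]. A finite digraph is a relation on a [finType] of vertices
    (loops allowed, since a connection set may contain 1); it is a graph when
    the relation is symmetric. *)

Section Digraphs.

Variables (V : finType) (e : rel V).

Definition digraph_aut : {set {perm V}} :=
  [set s : {perm V} | [forall x, forall y, e (s x) (s y) == e x y]].

Lemma digraph_autP (s : {perm V}) :
  reflect (forall x y, e (s x) (s y) = e x y) (s \in digraph_aut).
Proof.
rewrite inE; apply: (iffP forallP) => [H x y|H x].
  by move/forallP/(_ y)/eqP: (H x).
by apply/forallP=> y; apply/eqP.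
Qed.

Lemma digraph_aut_group_set : group_set digraph_aut.
Proof.
apply/group_setP; split=> [|s t /digraph_autP Hs /digraph_autP Ht].
  by apply/digraph_autP=> x y; rewrite !perm1.
by apply/digraph_autP=> x y; rewrite !permM Ht Hs.
Qed.

Canonical digraph_aut_group := Group digraph_aut_group_set.

End Digraphs.

(** Regular action of a permutation group: transitive, with trivial point
    stabilisers. Transitivity in the sense of [atrans] forces [V] nonempty. *)
Definition regular_perms (V : finType) (A : {set {perm V}}) : Prop :=
  [transitive A, on [set: V] | 'P] /\ forall x : V, 'C_A[x | 'P] = 1.

Section Representations.

Variable gT : finGroupType.

Definition is_DRR (V : finType) (e : rel V) : Prop :=
  digraph_aut e \isog [set: gT] /\ regular_perms (digraph_aut e).

Definition is_GRR (V : finType) (e : rel V) : Prop :=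
  is_DRR e /\ symmetric e.

Definition admits_DRR : Prop := exists (V : finType) (e : rel V), is_DRR e.

Definition admits_GRR : Prop := exists (V : finType) (e : rel V), is_GRR e.

Definition Cay (S : {set gT}) : rel gT :=
  fun g1 g2 => [exists s in S, g2 == s * g1].

Definition AutS (S : {set gT}) : {set {perm gT}} :=
  [set f in Aut [set: gT] | [set f x | x in S] == S].

Definition inverse_closed (S : {set gT}) : Prop :=
  forall s, s \in S -> s^-1 \in S.

Definition DRR_detecting : Prop :=
  forall S : {set gT}, AutS S = 1 -> is_DRR (Cay S).

Definition GRR_detecting : Prop :=
  forall S : {set gT}, inverse_closed S -> AutS S = 1 -> is_GRR (Cay S).

End Representations.

Arguments is_DRR gT {V} e.
Arguments is_GRR gT {V} e.

(* Main.v *)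
Require Import Defs.
From mathcomp Require Import all_boot all_fingroup cyclic.

(** Write the given DRRs as Cayley digraphs on connection sets S1 and S2 that
    avoid 1, so that Aut(G_i, S_i) = 1. The connection set
    S = (S1 x G2) u ({1} x S2) yields the lexicographic product of the two
    digraphs. Coprimality makes every automorphism of G1 x G2 a product of
    automorphisms of the factors, and one fixing S then fixes S1 and S2, hence
    is trivial. But translating a single fibre {1} x G2 by an element of G2 is a
    nontrivial automorphism of the lexicographic product that fixes all other
    fibres, so the action is not regular. *)

Set Implicit Arguments.
Unset Strict Implicit.
Unset Printing Implicit Defensive.

Local Open Scope group_scope.

(** An injection mapping the finite set [S] into itself maps onto it, so one inclusion is enough. *)
Lemma AutS_eq1_id (gT : finGroupType) (S : {set gT}) (f : gT -> gT) :
    AutS S = 1 -> injective f -> {morph f : x y / x * y} ->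
    {in S, forall s, f s \in S} -> f =1 id.
Proof.
move=> S1 injf fM fS x.
have: perm injf \in AutS S.
  rewrite inE; apply/andP; split.
    rewrite inE; apply/andP; split; first by apply/subsetP=> y _; rewrite inE.
    by apply/morphicP=> y z _ _; rewrite !permE fM.
  rewrite eqEcard card_imset ?leqnn ?andbT; last exact: perm_inj.
  by apply/subsetP=> _ /imsetP[s sS ->]; rewrite permE fS.
by rewrite S1 => /set1P/permP/(_ x); rewrite permE perm1.
Qed.

Lemma AutS_eq1P (gT : finGroupType) (S : {set gT}) :
    (forall f : gT -> gT, injective f -> {morph f : x y / x * y} ->
       (forall x, (f x \in S) = (x \in S)) -> f =1 id) ->
  AutS S = 1.
Proof.
move=> idS; apply/eqP; rewrite eqEsubset; apply/andP; split; apply/subsetP=> f.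
  rewrite inE => /andP[/setIdP[_ /morphicP fM] /eqP fS]; apply/set1P/permP=> x.
  rewrite perm1; apply: idS => [|y z|y]; first exact: perm_inj.
    by rewrite fM ?inE.
  by rewrite -{1}fS mem_imset //; apply: perm_inj.
move/set1P->; rewrite inE group1 /=.
by apply/eqP/setP=> x; rewrite -{1}[x](perm1 x) mem_imset //; apply: perm_inj.
Qed.

(** Regularity makes the orbit map [a] of a base vertex [v] a bijection from the group to [V], and
    [e] becomes a Cayley relation. A group automorphism preserving the connection set then acts on
    [V] as a digraph automorphism fixing [v], so it is trivial. *)
Lemma DRR_connection_set (gT : finGroupType) (V : finType) (e : rel V) :
    is_DRR gT e ->
  exists S : {set gT},
    [/\ 1 \notin S, AutS S = 1 & symmetric e -> inverse_closed S].
Proof.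
case=> isoA [/imsetP[v _ orbv] stab1].
have /isogP[f injf imf]: [set: gT] \isog digraph_aut e by rewrite isog_sym.
have fM x y : f (x * y) = f x * f y by rewrite morphM ?inE.
have fA g : f g \in digraph_aut e by rewrite -imf mem_morphim ?inE.
have fE g x y : e (f g x) (f g y) = e x y by apply/digraph_autP.
pose a g := f g v.
have aM g h : a (g * h) = f h (a g) by rewrite /a fM permM.
have a_inj : injective a.
  move=> g h eq_gh; apply: (injmP injf); rewrite ?inE //.
  have: f (g * h^-1) \in 'C_(digraph_aut e)[v | 'P].
    apply/setIP; split=> //; apply/astab1P.
    by rewrite /= apermE -/(a _) aM eq_gh -aM mulgV /a morph1 perm1.
  by rewrite stab1 fM morphV ?in_setT // => /set1P/eqP; rewrite -eq_mulgV1 => /eqP.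
have a_surj x : exists g, a g == x.
  have: x \in orbit 'P (digraph_aut e) v by rewrite -orbv inE.
  case/orbitP=> s; rewrite -imf => /morphimP[g _ _ ->] <-.
  by exists g; rewrite /= apermE.
pose b x := xchoose (a_surj x).
have bK x : a (b x) = x by apply/eqP/(xchooseP (a_surj x)).
have aK g : b (a g) = g by apply: a_inj; rewrite bK.
(* Translating by [g^-1] moves the arc's tail to [v]: adjacency depends only on [h * g^-1]. *)
have eE g h : e (a g) (a h) = e v (a (h * g^-1)).
  by rewrite -(fE g v) -/(a g) -aM mulgKV.
have a1 : a 1 = v by rewrite /a morph1 perm1.
(* Excluding 1 forgets the loops. No rigidity is lost: any [p] below fixes 1, so it preserves loops
   anyway. *)
exists [set s | (s != 1) && e v (a s)]; split.
- by rewrite inE eqxx.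
- apply: AutS_eq1P => p injp pM pS g.
  (* [q] is [p] transported to the vertices along [a]. *)
  pose q x := a (p (b x)).
  have injq : injective q.
    by move=> x y /a_inj/injp eqb; rewrite -(bK x) eqb bK.
  have p1 : p 1 = 1 by apply: (mulgI (p 1)); rewrite -pM !mulg1.
  have pV x : p x^-1 = (p x)^-1.
    by apply: (mulgI (p x)); rewrite -pM !mulgV.
  have: perm injq \in 'C_(digraph_aut e)[v | 'P].
    apply/setIP; split; last first.
      by apply/astab1P; rewrite /= apermE permE /q -{1}a1 aK p1 a1.
    apply/digraph_autP=> x y; rewrite !permE /q eE -pV -pM.
    rewrite -{2}(bK x) -{2}(bK y) eE.
    move: (b y * _) => s; have := pS s; rewrite !inE -{1}p1 (inj_eq injp).
    by have [-> _ | //] := eqVneq s 1; rewrite p1.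
  rewrite stab1 => /set1P/permP/(_ (a g)); rewrite permE perm1 /q aK.
  exact: a_inj.
- move=> symE s; rewrite !inE invg_eq1 => /andP[-> /=].
  by have := eE s^-1 1; rewrite a1 mul1g invgK symE => ->.
Qed.

(** The order of [f x] divides both the order of [x] and that of the target group. *)
Lemma coprime_morph_trivial (aT rT : finGroupType) (f : aT -> rT) :
    coprime #|[set: aT]| #|[set: rT]| -> {morph f : x y / x * y} ->
  forall x, f x = 1.
Proof.
move=> co fM x.
have fM' : {in [set: aT] &, {morph f : x y / x * y}} by move=> y z _ _.
have fX : f x ^+ #[x] = 1.
  by have := morphX (Morphism fM') #[x] (in_setT x); rewrite expg_order morph1.
apply/eqP; rewrite -order_eq1 -dvdn1 -(eqP co) dvdn_gcd order_dvdG ?inE //.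
by rewrite andbT (dvdn_trans _ (order_dvdG (in_setT x))) // order_dvdn fX.
Qed.

Section Lexicographic.

Variables (gT1 gT2 : finGroupType) (S1 : {set gT1}) (S2 : {set gT2}).

Definition lex_set : {set (gT1 * gT2)%type} :=
  [set p | (p.1 \in S1) || (p.1 == 1) && (p.2 \in S2)].

Lemma lex_set_inverse_closed :
  inverse_closed S1 -> inverse_closed S2 -> inverse_closed lex_set.
Proof.
move=> inv1 inv2 [x y]; rewrite !inE /= invg_eq1 => /orP[/inv1 -> // |].
by case/andP=> -> /inv2 ->; rewrite orbT.
Qed.

Lemma AutS_lex_set :
    coprime #|[set: gT1]| #|[set: gT2]| -> 1 \notin S1 ->
    AutS S1 = 1 -> AutS S2 = 1 ->
  AutS lex_set = 1.
Proof.
move=> co n1S1 aut1 aut2; apply: AutS_eq1P => f injf fM fS.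
pose i1 x : (gT1 * gT2)%type := (x, 1); pose i2 y : (gT1 * gT2)%type := (1, y).
have i1M : {morph i1 : x y / x * y}.
  by move=> x y; congr pair; rewrite /= ?mulg1.
have i2M : {morph i2 : x y / x * y}.
  by move=> x y; congr pair; rewrite /= ?mulg1.
have f1 x : (f (i1 x)).2 = 1.
  by apply: (coprime_morph_trivial (f := fun x => (f (i1 x)).2)) => // y z;
     rewrite i1M fM.
have f2 y : (f (i2 y)).1 = 1.
  by apply: (coprime_morph_trivial (f := fun y => (f (i2 y)).1));
     rewrite 1?coprime_sym // => x z; rewrite i2M fM.
pose f11 x := (f (i1 x)).1; pose f22 y := (f (i2 y)).2.
have fi1 x : f (i1 x) = i1 (f11 x) by rewrite [LHS]surjective_pairing f1.
have fi2 y : f (i2 y) = i2 (f22 y) by rewrite [LHS]surjective_pairing f2.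
have inj11 : injective f11.
  by move=> x y eqf; have: f (i1 x) = f (i1 y) by [rewrite !fi1 eqf]; case/injf.
have inj22 : injective f22.
  by move=> x y eqf; have: f (i2 x) = f (i2 y) by [rewrite !fi2 eqf]; case/injf.
have M11 : {morph f11 : x y / x * y} by move=> x y; rewrite /f11 i1M fM.
have M22 : {morph f22 : x y / x * y} by move=> x y; rewrite /f22 i2M fM.
have f11_1 : f11 1 = 1 by apply: (mulgI (f11 1)); rewrite -M11 !mulg1.
have id11 : f11 =1 id.
  apply: (AutS_eq1_id aut1) => // s sS.
  have := fS (i1 s); rewrite fi1 !inE /= sS -{1}f11_1 (inj_eq inj11).
  (* As [s] is not 1, neither is [f11 s], so [i1 (f11 s)] can lie in [lex_set] only through [S1]. *)
  have [s1 | _] := eqVneq s 1; first by rewrite -s1 sS in n1S1.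
  by rewrite orbF.
have id22 : f22 =1 id.
  apply: (AutS_eq1_id aut2) => // s sS.
  by have := fS (i2 s); rewrite fi2 !inE /= sS eqxx (negPf n1S1).
move=> [x y]; have -> : (x, y) = i1 x * i2 y.
  by congr pair; rewrite /= ?mulg1 ?mul1g.
by rewrite fM fi1 fi2 id11 id22.
Qed.

Lemma Cay_lex_set x y x' y' :
  Cay lex_set (x, y) (x', y')
    = (x' * x^-1 \in S1) || (x' == x) && (y' * y^-1 \in S2).
Proof.
have -> : Cay lex_set (x, y) (x', y') = ((x' * x^-1, y' * y^-1) \in lex_set).
  apply/exists_inP/idP => [[[s t] stS /eqP[-> ->]] | inS].
    by rewrite !mulgK.
  exists (x' * x^-1, y' * y^-1) => //.
  by apply/eqP; congr pair; rewrite /= mulgKV.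
by rewrite inE /= -eq_mulgV1.
Qed.

Lemma Cay_lex_set_not_DRR (rT : finGroupType) :
    [set: gT1] <> 1 -> [set: gT2] <> 1 -> ~ is_DRR rT (Cay lex_set).
Proof.
move=> /eqP/trivgPn[x _ nx1] /eqP/trivgPn[y _ ny1] [_ [_ stab1]].
(* Right multiplication by [y] preserves the quotients [y' * y^-1] that define arcs inside the fibre
   over 1, and arcs between fibres ignore second coordinates. The map [t] fixes [(x, 1)] because [x]
   is not 1, but moves [(1, 1)]. *)
pose t (p : gT1 * gT2) := (p.1, if p.1 == 1 then p.2 * y else p.2).
have injt : injective t.
  by move=> [a b] [c d] [<-]; case: eqP => _ => [/mulIg|] ->.
have: perm injt \in 'C_(digraph_aut (Cay lex_set))[(x, 1) | 'P].
  apply/setIP; split; last first.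
    by apply/astab1P; rewrite /= apermE permE /t /= (negPf nx1).
  apply/digraph_autP=> [[a b] [c d]]; rewrite !permE /t /= !Cay_lex_set.
  have [-> | //] := eqVneq c a; case: eqP => // _.
  by rewrite invMg mulgA mulgK.
rewrite stab1 => /set1P/permP/(_ (1, 1)).
by rewrite permE perm1 /t /= eqxx mul1g => -[y1]; rewrite y1 eqxx in ny1.
Qed.

End Lexicographic.

Theorem theorem1p8 (gT1 gT2 : finGroupType)
    (ntG1 : [set: gT1] <> 1%g) (ntG2 : [set: gT2] <> 1%g)
    (coG12 : coprime #|[set: gT1]| #|[set: gT2]|) :
  (admits_DRR gT1 -> admits_DRR gT2 -> ~ DRR_detecting (gT1 * gT2)%type) /\
  (admits_GRR gT1 -> admits_GRR gT2 -> ~ GRR_detecting (gT1 * gT2)%type).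
Proof.
split.
- move=> [V1 [e1 /DRR_connection_set[S1 [n1S1 aut1 _]]]].
  move=> [V2 [e2 /DRR_connection_set[S2 [_ aut2 _]]]] detect.
  apply: (Cay_lex_set_not_DRR ntG1 ntG2 (detect (lex_set S1 S2) _)).
  exact: AutS_lex_set.
- move=> [V1 [e1 [/DRR_connection_set[S1 [n1S1 aut1 inv1]] /inv1 {}inv1]]].
  move=> [V2 [e2 [/DRR_connection_set[S2 [_ aut2 inv2]] /inv2 {}inv2]]] detect.
  have invS := lex_set_inverse_closed inv1 inv2.
  have [drr _] := detect _ invS (AutS_lex_set coG12 n1S1 aut1 aut2).
  exact: Cay_lex_set_not_DRR ntG1 ntG2 drr.
Qed.
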